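(* Let $\nu,\mu$ be probability measures on Cantor space $2^{\mathbb{N}}$ with full support. Then $\nu\ll_{bd}\mu$ implies $\nu\ll_{kl}\mu$.
   Context: A probability measure $\nu$ on Cantor space is identified with the function $\sigma\mapsto\nu(\sigma):=\nu([\sigma])$ on $2^{<\mathbb{N}}$, where $[\sigma]$ is the set of $\omega\in 2^{\mathbb{N}}$ extending $\sigma$; it has full support if $\nu(\sigma)>0$ for all $\sigma$. $\omega\upharpoonright n$ is the length-$n$ initial segment of $\omega$. $\nu\ll_{bd}\mu$ iff $\mathbb{E}_{\nu}\sup_n\frac{\nu(\cdot\upharpoonright n)}{\mu(\cdot\upharpoonright n)}$ (expectation of $\omega\mapsto\sup_n \frac{\nu(\omega\upharpoonright n)}{\mu(\omega\upharpoonright n)}$) is finite. $\nu\ll_{kl}\mu$ iff $\sup_n \mathbb{E}_{\nu}\ln\frac{\nu(\cdot\upharpoonright n)}{\mu(\cdot\upharpoonright n)}$ is finite. *)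

(* Defs.v *)
From HB Require Import structures.
From mathcomp Require Import all_boot all_order all_algebra.
From mathcomp Require Import all_classical all_reals all_analysis.

Set Implicit Arguments.
Unset Strict Implicit.
Unset Printing Implicit Defensive.

Import Order.TTheory GRing.Theory Num.Theory.
Import numFieldNormedType.Exports.

Local Open Scope classical_set_scope.
Local Open Scope ring_scope.

(* [cantor_space] with its Borel sigma-algebra. *)
Notation cantor_borel := (g_sigma_algebraType (@open cantor_space)).

Definition prefix_of (w : cantor_space) (n : nat) : seq bool :=
  mkseq (w : nat -> bool) n.

Definition cylinder (s : seq bool) : set cantor_borel :=
  [set w | prefix_of w (size s) = s].

Lemma prefix_ofS (w : cantor_space) n :
  prefix_of w n.+1 = rcons (prefix_of w n) (w n).
Proof. exact: mkseqS. Qed.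

Lemma open_cylinder (s : seq bool) : open (cylinder s : set cantor_space).
Proof.
elim/last_ind: s => [|s b IH].
  suff -> : cylinder [::] = setT by exact: openT.
  by rewrite predeqE.
suff -> : cylinder (rcons s b) =
    cylinder s `&` (@proj nat (fun=> bool) (size s)) @^-1` [set b].
  apply: openI => //; apply: open_comp; last exact: discrete_open.
  by move=> w _; exact: (@proj_continuous nat (fun=> bool) (size s)).
rewrite predeqE => w; rewrite /cylinder /= size_rcons prefix_ofS.
split=> [/rcons_inj[]|[-> /= <-]] //.
Qed.

Lemma measurable_cylinder (s : seq bool) : measurable (cylinder s).
Proof. by apply: sub_sigma_algebra; exact: open_cylinder. Qed.

Section cantor_measures.
Context {R : realType}.
Implicit Types nu mu : probability cantor_borel R.

(* The function on binary strings identified with [nu]; [fine] loses nothing,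
   as probabilities are finite. *)
Definition string_mass nu (s : seq bool) : R := fine (nu (cylinder s)).

Definition full_support nu : Prop := forall s, 0 < string_mass nu s.

Definition mass_ratio nu mu (s : seq bool) : R :=
  string_mass nu s / string_mass mu s.

(* The supremum may be infinite, so the expectation is the integral of an
   extended real function, which the library's 'E_nu[_] does not cover. *)
Definition ll_bd nu mu : Prop :=
  (\int[nu]_w ereal_sup (range (fun n => (mass_ratio nu mu (prefix_of w n))%:E))
     \is a fin_num)%E.

Definition ll_kl nu mu : Prop :=
  (ereal_sup (range (fun n => 'E_nu[fun w => ln (mass_ratio nu mu (prefix_of w n))]))
     \is a fin_num)%E.

End cantor_measures.

(* Main.v *)
Require Import Defs.
From HB Require Import structures.
From mathcomp Require Import all_boot all_order all_algebra.
From mathcomp Require Import all_classical all_reals all_analysis.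

Import Order.TTheory GRing.Theory Num.Theory.

Local Open Scope classical_set_scope.
Local Open Scope ring_scope.

(* Every ratio is at most its supremum M over n, and M >= 0, so
   ln x <= x gives E_nu[ln (nu_n / mu_n)] <= E_nu[M] for every n; the term n = 0
   is E_nu[ln 1] = 0, which bounds the supremum of these expectations below. *)

(* No measurability is needed: the integral of a nonnegative function is a
   supremum over the simple functions below it. *)
Lemma le_integral_ge0_majorant d (T : measurableType d) (R : realType)
    (mu : {measure set T -> \bar R}) (D : set T) (f g : T -> \bar R) :
    (forall x, D x -> 0 <= g x)%E -> (forall x, D x -> f x <= g x)%E ->
  (\int[mu]_(x in D) f x <= \int[mu]_(x in D) g x)%E.
Proof.
move=> g0 fg; rewrite integralE.
(* Dropping the integral of the negative part of [f] can only increase the value. *)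
apply: (@le_trans _ _ (\int[mu]_(x in D) f^\+%E x)%E).
  by rewrite geeDl// oppe_le0 integral_ge0.
rewrite !ge0_integralE//.
(* A simple function below [f^\+] is also below [g], so the supremum for [g] runs over a larger
   set. *)
apply: le_ereal_sup => _ [h /= hf <-]; exists h => // x.
apply: (le_trans (hf x)); apply: lee_restrict => y Dy.
by rewrite funeposE ge_max fg// g0.
Qed.

Lemma ln_le_id (R : realType) (x : R) : 0 <= x -> ln x <= x.
Proof.
(* At [x = 0] the default value [ln 0 = 0] gives equality. *)
rewrite le_eqVlt => /predU1P[<-|x0]; first by rewrite ln0.
exact/ltW/ln_sublinear.
Qed.

Section ratios.
Context {R : realType}.
Implicit Types nu mu : probability cantor_borel R.

Lemma string_mass_nil nu : string_mass nu [::] = 1.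
Proof.
rewrite /string_mass (_ : cylinder [::] = setT) ?probability_setT //.
by rewrite predeqE.
Qed.

Lemma mass_ratio_nil nu mu : mass_ratio nu mu [::] = 1.
Proof. by rewrite /mass_ratio !string_mass_nil divr1. Qed.

Lemma mass_ratio_ge0 nu mu s : 0 <= mass_ratio nu mu s.
Proof. by rewrite divr_ge0 // fine_ge0. Qed.

End ratios.

Theorem proposition6p4 (R : realType) (nu mu : probability cantor_borel R) :
  full_support nu -> full_support mu -> ll_bd nu mu -> ll_kl nu mu.
Proof.
move=> _ _; rewrite /ll_bd /ll_kl.
set M := fun w => ereal_sup _ => fin_M.
have ratio_le_M w n : ((mass_ratio nu mu (prefix_of w n))%:E <= M w)%E.
  by apply: ereal_sup_ubound; exists n.
rewrite fin_real//; apply/andP; split.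
  apply: (@lt_le_trans _ _ 0%E); first exact: ltNyr.
  apply: ereal_sup_ubound; exists 0%N => //.
  (* The prefix of length 0 is [[::]] for every [w], so the integrand vanishes identically. *)
  rewrite unlock; apply: integral0_eq => w _.
  by rewrite mass_ratio_nil ln1.
apply: (@le_lt_trans _ _ (\int[nu]_w M w)%E); last by rewrite ltey_eq fin_M.
apply: ge_ereal_sup => _ [n _ <-]; rewrite unlock.
apply: le_integral_ge0_majorant => w _.
  (* [M w] is nonnegative because it dominates a nonnegative ratio; any index would serve. *)
  by apply: le_trans (ratio_le_M w 0%N); rewrite lee_fin mass_ratio_ge0.
by apply: le_trans (ratio_le_M w n); rewrite lee_fin ln_le_id// mass_ratio_ge0.
Qed.
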